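(* Let $d\ge 1$ and $n\ge 1$ be integers, and let $P\in\mathbb R[x_1,\ldots,x_d]$ be a polynomial of degree $n$ whose restriction to the unit sphere $S^{d-1}\subset\mathbb R^d$ is not identically zero. Suppose that $|P|$ restricted to $S^{d-1}$ attains its maximum at a point $p\in S^{d-1}$ and that $p$ is at angular distance precisely $\frac{\pi}{2n}$ from the intersection of the zero set of $P$ with $S^{d-1}$. Then there exists a circle $\Sigma\subseteq S^{d-1}$ through $p$ centered at the origin such that the $2n$ zeros of the restriction $P|_\Sigma$ and the $2n$ maximum points of the absolute value of $P|_\Sigma$ interlace and split the circle $\Sigma$ into $4n$ segments (arcs) of length $\frac{\pi}{2n}$ each.
   Context: $S^{d-1}$ is the Euclidean unit sphere centered at the origin of $\mathbb R^d$. The angular distance between $u,v\in S^{d-1}$ is $\arccos\langle u,v\rangle\in[0,\pi]$; the angular distance from a point $p$ to a nonempty set is the infimum of the angular distances from $p$ to points of that set. A circle in $S^{d-1}$ centered at the origin is the intersection of $S^{d-1}$ with a two-dimensional linear subspace of $\mathbb R^d$. The conclusion means that $P|_\Sigma$ has exactly $2n$ distinct zeros, that $|P|_\Sigma|$ attains its maximum over $\Sigma$ at exactly $2n$ points, and that these $4n$ points alternate (zero, maximum, zero, maximum, ...) along $\Sigma$ with consecutive ones at angular distance $\frac{\pi}{2n}$. *)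

(* Defs.v *)
(* Only the canonical structures and coercions of mpoly are imported: its
   notations clash with those of MathComp-Analysis. *)
From mathcomp Require Import all_boot all_order all_algebra.
From mathcomp Require Import all_classical all_reals all_analysis.
From mathcomp Require mpoly.
Import (canonicals, coercions) mpoly.

Set Implicit Arguments.
Unset Strict Implicit.
Unset Printing Implicit Defensive.

Import Order.TTheory GRing.Theory Num.Theory.

Local Open Scope classical_set_scope.
Local Open Scope ring_scope.

Section Sphere.
Context {R : realType} {d : nat}.
Implicit Types (u v x : 'rV[R]_d) (A S Z M : set 'rV[R]_d).

Definition dot u v : R := \sum_(i < d) u 0 i * v 0 i.

(* S^(d-1) in R^d. *)
Definition sphere : set 'rV[R]_d := [set x | dot x x = 1].

Definition angdist u v : R := acos (dot u v).

(* [inf] is junk (0) on the empty set: only meaningful for nonempty A. *)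
Definition angdist_set u A : R := inf [set angdist u v | v in A].

Definition circle S : Prop :=
  exists2 W : {vspace 'rV[R]_d}, \dim W = 2%N & S = sphere `&` [set` W].

Definition orthonormal2 u v : Prop := [/\ dot u u = 1, dot v v = 1 & dot u v = 0].

(* For orthonormal (u, v), the unit-speed parametrization of the circle spanned
   by u and v: parameter length is arc length. *)
Definition circle_point u v (t : R) : 'rV[R]_d := cos t *: u + sin t *: v.

(* Going once around S, one meets the 4n points at the parameters
   t 0 < t 1 < ... < t (4n - 1) < t (4n) = t 0 + 2 pi, the last parameter giving
   back the first point.  The points of even index are those of Z, the points
   of odd index those of M. *)
Definition interlace_and_split (n : nat) S Z M : Prop :=
  exists u v (t : nat -> R),
    let q k := circle_point u v (t k) in
    [/\ orthonormal2 u v /\ S = range (circle_point u v),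
        (forall k, (k < 4 * n)%N -> t k < t k.+1) /\ t (4 * n)%N = t 0%N + 2 * pi,
        Z = [set q (2 * j)%N | j in `I_(2 * n)] /\
        M = [set q (2 * j).+1 | j in `I_(2 * n)],
        forall k, (k < 4 * n)%N -> t k.+1 - t k = pi / (2 * n)%:R &
        forall k, (k < 4 * n)%N -> angdist (q k) (q k.+1) = pi / (2 * n)%:R].

Definition peval (P : mpoly.mpoly d R) x : R := mpoly.meval (fun i => x 0 i) P.

(* [msize] is the total degree plus one, and 0 for the zero polynomial. *)
Definition has_degree (P : mpoly.mpoly d R) (n : nat) : Prop :=
  mpoly.msize P = n.+1.

Definition zeros_on (P : mpoly.mpoly d R) S : set 'rV[R]_d :=
  [set x | S x /\ peval P x = 0].

Definition abs_max_on (P : mpoly.mpoly d R) S : set 'rV[R]_d :=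
  [set x | S x /\ forall y, S y -> `|peval P y| <= `|peval P x|].

End Sphere.

(* Main.v *)
Require Import Defs.
From mathcomp Require Import all_boot all_order all_algebra.
From mathcomp Require Import all_classical all_reals all_analysis.
From mathcomp Require mpoly.
From mathcomp Require Import ring lra zify.
Import (canonicals) mpoly.

(** Let [z] be a zero of [P] on the sphere nearest to [p], and consider the great
    circle through [p] and [z].  Along it, at unit speed from [p], [P] is a
    trigonometric polynomial [f] of degree at most [n]; its absolute value is
    greatest at [t = 0], where it equals some [M > 0], and [f] vanishes at
    [t = pi / (2 n)], the distance from [p] to [z].  After a change of sign,
    [f 0 = M].  It is enough to show that [f t = M * cos (n t)]
    ([cos_extremal]): the zeros and the extrema of this cosine are the points at
    the odd and at the even multiples of [pi / (2 n)] ([interlace_cosine]).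

    The proof counts the zeros of the difference [g t = M * cos (n t) - f t],
    a trigonometric polynomial of degree at most [n].  At [t = k pi / n] the
    cosine is [(-1) ^ k], so there [g] has the sign of [(-1) ^ k], in the weak
    sense; at [t = 0] both terms of [g] have the same maximum [M], so [g] has a
    double zero; and [g] vanishes at [pi / (2 n)].  In the coordinate
    [tan ((t - c) / 2)], for a suitable centre [c], [g] becomes a real polynomial
    of degree at most [2 n].  Dividing out the three zeros leaves a polynomial of
    degree at most [2 n - 3] whose weak signs alternate at the [2 n - 1] points
    [k pi / n], [0 < k < 2 n], because all these points lie on the same side of
    the three zeros.  Such a polynomial is zero ([alternating_poly_eq0]), hence so
    is [g]. *)

Import Order.TTheory GRing.Theory Num.Theory.
Import numFieldNormedType.Exports.

Local Open Scope classical_set_scope.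
Local Open Scope card_scope.
Local Open Scope ring_scope.

(** * Real polynomials with alternating signs *)

Lemma size_mulXsubC {A : idomainType} {p : {poly A}} {a : A} :
  p != 0 -> size (p * ('X - a%:P)) = (size p).+1.
Proof.
by move=> p0; rewrite size_Mmonic ?monicXsubC // size_XsubC addnC.
Qed.

(** The weak-sign form of counting roots by sign changes: a strictly alternating
    [K] would have [m] roots, one in each gap, hence be zero.  With weak signs
    two gaps may share a root at their common end point, so the proof removes
    one root at a time instead: a root [r] of the first gap is divided out, and
    the quotient alternates on the remaining points, where [s 0] takes over
    from [s 1] in case [r] is [s 1]. *)
Lemma alternating_poly_eq0 (R : rcfType) (m : nat) (K : {poly R}) (s : nat -> R) :
  (size K <= m)%N ->
  (forall i j, (i < j)%N -> (j <= m)%N -> s i < s j) ->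
  (forall i, (i <= m)%N -> 0 <= (-1) ^+ i * K.[s i]) -> K = 0.
Proof.
elim: m K s => [|m IHm] K s szK s_inc s_alt.
  by apply/eqP; rewrite -size_poly_leq0.
have lt01 : s 0%N < s 1%N by exact: s_inc.
have [r /andP[s0r rs1] rootr] : exists2 r, s 0%N <= r <= s 1%N & root (- K) r.
  apply: poly_ivt; first exact: ltW.
  have := s_alt 0%N isT; have := s_alt 1%N isT.
  by rewrite !hornerN expr0 expr1 mul1r mulN1r oppr_le0 => -> ->.
have [L KE] : exists L, K = L * ('X - r%:P) by apply/factor_theorem; rewrite -rootN.
have [L0|L_neq0] := eqVneq L 0; first by rewrite KE L0 mul0r.
suff L0 : - L = 0 by rewrite KE -[L]opprK L0 oppr0 mul0r.
pose s' i := if (i == 0%N) && (r == s 1%N) then s 0%N else s i.+1.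
apply: (IHm _ s').
- by rewrite size_polyN -ltnS -(size_mulXsubC (a := r) L_neq0) -KE.
- move=> i j ij jm; have j0 : (j == 0%N) = false by lia.
  rewrite /s' j0 /=; case: ifP => _; apply: s_inc; lia.
- move=> i im; rewrite hornerN mulrN -mulNr -mulN1r -exprS /s'.
  case: ifP => [/andP[/eqP-> /eqP rE]|nb].
    (* dividing by [s 0 - s 1 < 0] turns the sign at [s 0] into that at [s 1] *)
    have := s_alt 0%N isT; rewrite KE !hornerE rE => h.
    rewrite expr1; nra.
  have ri : r < s i.+1.
    case: i im nb => [_ /= /negbT nr|i im _].
      by rewrite lt_neqAle nr.
    by apply: (le_lt_trans rs1); apply: s_inc; lia.
  have := s_alt i.+1 ltac:(lia); rewrite KE hornerM hornerXsubC mulrA.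
  by rewrite pmulr_lge0 // subr_gt0.
Qed.

(** The cofactor of ['X - a] is nonpositive to the left of [a], nonnegative to
    its right, and continuous. *)
Lemma nonneg_poly_double_root (R : realType) (p : {poly R}) (a : R) :
  (forall x, 0 <= p.[x]) -> root p a -> exists q, p = q * ('X - a%:P) ^+ 2.
Proof.
move=> p_ge0 /factor_theorem[q pE].
suff /factor_theorem[r qE] : root q a by exists r; rewrite pE qE -mulrA.
have qc : q.[x] @[x --> a] --> q.[a] by exact: continuous_horner.
rewrite rootE; apply/eqP/le_anti/andP; split.
  have : q.[x] @[x --> a^'-] --> q.[a] by apply: cvg_at_left_filter.
  move/cvgr_to_le; apply; near=> x.
  have := p_ge0 x; rewrite pE hornerM hornerXsubC nmulr_lge0 // subr_lt0.
  by near: x; exact: nbhs_left_lt.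
have : q.[x] @[x --> a^'+] --> q.[a] by apply: cvg_at_right_filter.
move/cvgr_to_ge; apply; near=> x.
have := p_ge0 x; rewrite pE hornerM hornerXsubC pmulr_lge0 // subr_gt0.
by near: x; exact: nbhs_right_gt.
Unshelve. all: by end_near. Qed.

(** * Trigonometric polynomials in the half-angle coordinate *)

Section HalfAngle.
Context {R : realType}.
Implicit Types (c t : R) (f g : R -> R).

(** Trigonometric polynomials of degree at most [n], through the half-angle
    substitution: [f t] times [(1 + tan^2 h) ^ n], where [h = (t - c) / 2], is a
    polynomial in [tan h] of degree at most [2 n].  The centre [c] is
    arbitrary because each chart misses the point opposite to [c] and only sees
    the circle cut open there, as an ordered line. *)
Definition trig_poly (n : nat) f : Prop :=
  forall c, exists2 F : {poly R}, (size F <= n.*2.+1)%N &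
    forall t, cos ((t - c) / 2) != 0 ->
      f t = cos ((t - c) / 2) ^+ n.*2 * F.[tan ((t - c) / 2)].

Lemma eq_trig_poly n f g : g =1 f -> trig_poly n f -> trig_poly n g.
Proof. by move=> /funext ->. Qed.

Lemma trig_poly_cst (k : R) : trig_poly 0 (fun=> k).
Proof.
move=> c; exists k%:P => [|t _]; first exact: size_polyC_leq1.
by rewrite hornerC expr0 mul1r.
Qed.

Lemma trig_polyD n f g :
  trig_poly n f -> trig_poly n g -> trig_poly n (fun t => f t + g t).
Proof.
move=> hf hg c; have [F szF fE] := hf c; have [G szG gE] := hg c.
exists (F + G) => [|t ct]; last by rewrite fE // gE // hornerD mulrDr.
by rewrite (leq_trans (size_polyD _ _)) // geq_max szF.
Qed.

Lemma trig_polyM m n f g :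
  trig_poly m f -> trig_poly n g -> trig_poly (m + n) (fun t => f t * g t).
Proof.
move=> hf hg c; have [F szF fE] := hf c; have [G szG gE] := hg c.
exists (F * G) => [|t ct].
  rewrite (leq_trans (size_polyMleq _ _)) //.
  have := leq_add szF szG; lia.
by rewrite fE // gE // hornerM doubleD exprD; ring.
Qed.

Lemma trig_poly_widen m n f : (m <= n)%N -> trig_poly m f -> trig_poly n f.
Proof.
move=> /subnK <- hf; elim: (n - m)%N => // {}n IHn c; rewrite addSn.
move: IHn => /(_ c); move: (n + m)%N => k [F szF fE].
exists (F * (1 + 'X^2)) => [|t ct].
  rewrite (leq_trans (size_polyMleq _ _)) // addrC size_addl ?size_polyXn ?size_poly1 //.
  lia.
have cos_tan : cos ((t - c) / 2) ^+ 2 * (1 + tan ((t - c) / 2) ^+ 2) = 1.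
  by rewrite -cos2_tan2 // mulfV // expf_neq0.
rewrite fE // doubleS -[k.*2.+2]addn2 [in RHS]exprD hornerM hornerD hornerXn hornerC.
by rewrite -mulrA (mulrCA (cos _ ^+ 2)) cos_tan mulr1.
Qed.

Lemma trig_polyZ n k f : trig_poly n f -> trig_poly n (fun t => k * f t).
Proof. exact: (@trig_polyM 0 n _ f (trig_poly_cst k)). Qed.

Lemma size_half_angle_numer (a b : R) :
  (size (a *: (1 - 'X^2) + b *: 'X : {poly R})%R <= 3)%N.
Proof.
have X2 : size (1 - 'X^2 : {poly R}) = 3.
  by rewrite addrC size_addl ?size_polyN ?size_polyXn ?size_poly1.
rewrite (leq_trans (size_polyD _ _)) // geq_max.
rewrite (leq_trans (size_scale_leq _ _)) ?X2 //=.
by rewrite (leq_trans (size_scale_leq _ _)) // size_polyX.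
Qed.

Lemma trig_poly_cos : trig_poly 1 cos.
Proof.
move=> c; exists (cos c *: (1 - 'X^2) + (- (2 * sin c)) *: 'X) => [|t ct].
  exact: size_half_angle_numer.
have tE : t = c + ((t - c) / 2 + (t - c) / 2) by field.
rewrite {1}tE; move: ct; set h := _ / 2 => ct.
rewrite !cosD !sinD !hornerE /tan /= -[1.*2]/2%N; field; exact: ct.
Qed.

Lemma trig_poly_sin : trig_poly 1 sin.
Proof.
move=> c; exists (sin c *: (1 - 'X^2) + (2 * cos c) *: 'X) => [|t ct].
  exact: size_half_angle_numer.
have tE : t = c + ((t - c) / 2 + (t - c) / 2) by field.
rewrite {1}tE; move: ct; set h := _ / 2 => ct.
rewrite !sinD !cosD !hornerE /tan /= -[1.*2]/2%N; field; exact: ct.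
Qed.

Lemma trig_poly_cos_sin_mul n :
  trig_poly n (fun t => cos (n%:R * t)) /\ trig_poly n (fun t => sin (n%:R * t)).
Proof.
elim: n => [|n [IHc IHs]].
  by split; [apply: eq_trig_poly (trig_poly_cst (cos 0))
            |apply: eq_trig_poly (trig_poly_cst (sin 0))] => t; rewrite mul0r.
rewrite -addn1; split.
  apply: (@eq_trig_poly _
    (fun t => cos (n%:R * t) * cos t + -1 * (sin (n%:R * t) * sin t))) => [t|].
    by rewrite natrD mulrDl mul1r cosD; ring.
  apply: trig_polyD; first exact: trig_polyM trig_poly_cos.
  by apply: trig_polyZ; exact: trig_polyM trig_poly_sin.
apply: (@eq_trig_poly _
  (fun t => sin (n%:R * t) * cos t + cos (n%:R * t) * sin t)) => [t|].
  by rewrite natrD mulrDl mul1r sinD.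
apply: trig_polyD; first exact: trig_polyM trig_poly_cos.
exact: trig_polyM trig_poly_sin.
Qed.

Lemma trig_poly_sum (I : eqType) (r : seq I) n (h : I -> R -> R) :
  (forall i, i \in r -> trig_poly n (h i)) ->
  trig_poly n (fun t => \sum_(i <- r) h i t).
Proof.
elim: r => [|i r IHr] hh.
  apply: (@eq_trig_poly _ (fun=> 0)) => [t|]; first by rewrite big_nil.
  exact: trig_poly_widen (leq0n _) (trig_poly_cst 0).
apply: (@eq_trig_poly _ (fun t => h i t + \sum_(j <- r) h j t)) => [t|].
  by rewrite big_cons.
apply: trig_polyD; first by apply: hh; rewrite mem_head.
by apply: IHr => j jr; apply: hh; rewrite inE jr orbT.
Qed.

Lemma trig_polyX m k f : trig_poly m f -> trig_poly (k * m) (fun t => f t ^+ k).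
Proof.
move=> hf; elim: k => [|k IHk]; first exact: trig_poly_cst.
rewrite mulSn; apply: (@eq_trig_poly _ (fun t => f t * f t ^+ k)) => [t|].
  by rewrite exprS.
exact: trig_polyM.
Qed.

Lemma trig_poly_prod (I : Type) (r : seq I) (e : I -> nat) (h : I -> R -> R) :
  (forall i, trig_poly (e i) (h i)) ->
  trig_poly (\sum_(i <- r) e i) (fun t => \prod_(i <- r) h i t).
Proof.
move=> hh; elim: r => [|i r IHr].
  rewrite big_nil; apply: (@eq_trig_poly _ (fun=> 1)) => [t|].
    by rewrite big_nil.
  exact: trig_poly_cst.
rewrite big_cons.
apply: (@eq_trig_poly _ (fun t => h i t * \prod_(j <- r) h j t)) => [t|].
  by rewrite big_cons.
exact: trig_polyM.
Qed.

Lemma trig_poly_circle d n (P : mpoly.mpoly d R) (u v : 'rV[R]_d) :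
  has_degree P n -> trig_poly n (fun t => peval P (circle_point u v t)).
Proof.
move=> degP.
pose h m t := mpoly.mcoeff m P *
  \prod_(i < d) circle_point u v t 0 i ^+ mpoly.fun_of_multinom m i.
apply: (@eq_trig_poly _ (fun t => \sum_(m <- mpoly.msupp P) h m t)) => [t|].
  by rewrite /peval mpoly.mevalE.
apply: (@trig_poly_sum _ _ n h) => m /mpoly.msize_mdeg_lt; rewrite degP ltnS => mn.
apply/trig_polyZ; apply: (trig_poly_widen _ _ _ mn); rewrite mpoly.mdegE.
apply: trig_poly_prod => i; rewrite -[X in trig_poly X _]muln1.
apply: trig_polyX.
apply: (@eq_trig_poly _ (fun t => u 0 i * cos t + v 0 i * sin t)) => [t|].
  by rewrite !mxE mulrC [sin _ * _]mulrC.
by apply: trig_polyD; apply: trig_polyZ; [exact: trig_poly_cos|exact: trig_poly_sin].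
Qed.

End HalfAngle.

(** * The extremal property of the cosine *)

Section CosExtremal.
Context {R : realType}.

Lemma cos_natmul_pi (k : nat) : cos (k%:R * pi) = (-1) ^+ k :> R.
Proof.
by rewrite mulr_natl -[pi *+ k]add0r (alternatingn (@cosDpi R)) cos0 mulr1.
Qed.

(** Riesz's comparison with [M * cos (n t)], read in one half-angle chart.  The
    range of [c] is that for which the chart centred at [c] shows the points
    [0], [pi / (2 n)] and [k pi / n], for [0 < k < 2 n], in increasing order. *)
Lemma cos_extremal_chart (n : nat) (M c : R) (f : R -> R) :
  (0 < n)%N -> trig_poly n f -> (forall t, `|f t| <= M) -> f 0 = M ->
  f (pi / (2 * n)%:R) = 0 -> pi - pi / n%:R < c < pi ->
  forall t, cos ((t - c) / 2) != 0 -> f t = M * cos (n%:R * t).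
Proof.
move=> n_gt0 trigf f_norm f0 fd /andP[c_gt c_lt].
have f_le t : f t <= M by have := f_norm t; rewrite ler_norml => /andP[].
have f_ge t : - M <= f t by have := f_norm t; rewrite ler_norml => /andP[].
have pi0 : 0 < pi :> R := pi_gt0 R.
have nR : 0 < n%:R :> R by rewrite ltr0n.
pose d : R := pi / (2 * n)%:R.
have piE : pi = 2 * n%:R * d by rewrite /d natrM; field; rewrite gt_eqF.
have pinE : pi / n%:R = 2 * d by rewrite piE; field; rewrite gt_eqF.
have d_gt0 : 0 < d by rewrite divr_gt0 // ltr0n muln_gt0.
rewrite pinE in c_gt; rewrite -/d in fd.
have n_ge1 : 1 <= n%:R :> R by rewrite ler1n.
have d_le : 2 * d <= pi by rewrite piE; nra.
pose a t : R := (t - c) / 2; pose s t := tan (a t).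
have M_ge0 : 0 <= M by have := f_ge 0; rewrite f0; lra.
have [F szF fE] := trigf c.
have [C szC CE] := (trig_poly_cos_sin_mul n).1 c.
have [U szU UE] := trig_poly_widen _ _ _ (leq0n n) (trig_poly_cst (1 : R)) c.
pose w t := cos (a t) ^+ n.*2.
have aV x : a (c + 2 * atan x) = atan x by rewrite /a; field.
have w_gt0 t : cos (a t) != 0 -> 0 < w t.
  by move=> ct; rewrite /w -muln2 mulnC exprM exprn_gt0 // lt0r sqrf_eq0 ct sqr_ge0.
have chart x : exists2 t, cos (a t) != 0 & x = s t.
  exists (c + 2 * atan x); last by rewrite /s aV atanK.
  by rewrite aV gt_eqF // cos_gt0_pihalf // atan_gtNpi2 atan_ltpi2.
have ca t : c - pi < t < c + pi -> cos (a t) != 0 /\ a t \in `](- (pi / 2)), (pi / 2)[.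
  move=> ht; have hat : - (pi / 2) < a t < pi / 2 by rewrite /a; lra.
  by split; [rewrite gt_eqF // cos_gt0_pihalf|rewrite in_itv].
have s_inc t t' : c - pi < t -> t < t' -> t' < c + pi -> s t < s t'.
  move=> h1 h2 h3; have [_ i1] := ca t ltac:(lra); have [_ i2] := ca t' ltac:(lra).
  by rewrite /s ltr_tan // /a; lra.
have [c0 _] : cos (a 0) != 0 /\ a 0 \in `](- (pi / 2)), (pi / 2)[ by apply: ca; lra.
have [cd _] : cos (a d) != 0 /\ a d \in `](- (pi / 2)), (pi / 2)[.
  by apply: ca; nra.
(* [M - f] and [M - M cos (n t)] are nonnegative and vanish at [t = 0], so their
   difference vanishes there to the second order. *)
have [q1 E1] : exists q, M *: U - F = q * ('X - (s 0)%:P) ^+ 2.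
  apply: nonneg_poly_double_root => [x|].
    have [t ct ->] := chart x.
    rewrite -(pmulr_rge0 _ (w_gt0 t ct)) hornerD hornerN hornerZ mulrBr mulrCA.
    by rewrite -UE // -fE // mulr1 subr_ge0.
  rewrite rootE -(mulrI_eq0 _ (lregP (lt0r_neq0 (w_gt0 0 c0)))).
  rewrite hornerD hornerN hornerZ mulrBr mulrCA.
  by rewrite -UE // -fE // mulr1 f0 subrr.
have [q2 E2] : exists q, M *: U - M *: C = q * ('X - (s 0)%:P) ^+ 2.
  apply: nonneg_poly_double_root => [x|].
    have [t ct ->] := chart x.
    rewrite -(pmulr_rge0 _ (w_gt0 t ct)) hornerD hornerN !hornerZ mulrBr !(mulrCA (w t)).
    by rewrite -UE // -CE // mulr1 subr_ge0 ler_piMr // cos_le1.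
  rewrite rootE -(mulrI_eq0 _ (lregP (lt0r_neq0 (w_gt0 0 c0)))).
  rewrite hornerD hornerN !hornerZ mulrBr !(mulrCA (w 0)).
  by rewrite -UE // -CE // mulr0 cos0 subrr.
have GE : M *: C - F = (q1 - q2) * ('X - (s 0)%:P) ^+ 2.
  by rewrite mulrBl -E1 -E2; ring.
have Gval t : cos (a t) != 0 -> w t * (M *: C - F).[s t] = M * cos (n%:R * t) - f t.
  move=> ct; rewrite hornerD hornerN hornerZ mulrBr mulrCA.
  by rewrite -CE // -fE.
have [K KE] : exists K, q1 - q2 = K * ('X - (s d)%:P).
  apply/factor_theorem; rewrite rootE.
  have := Gval d cd; rewrite fd.
  have -> : n%:R * d = pi / 2 by rewrite piE; field.
  rewrite cos_pihalf mulr0 subr0 GE hornerM horner_exp hornerXsubC => /eqP.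
  have sd : s 0 < s d by apply: s_inc; lra.
  by rewrite !mulf_eq0 (gt_eqF (w_gt0 d cd)) subr_eq0 (gt_eqF sd) !orbF.
(* Three roots being divided out, the degree of [K] is at most [2 n - 3], and at
   the [2 n - 1] points [k pi / n] the sign of [M cos (n t) - f] is that of
   [(-1) ^ k].  The index [i] stands for [k - 1]. *)
have K0 : - K = 0.
  apply: (@alternating_poly_eq0 R n.-1.*2 _ (fun i => s (2 * i.+1%:R * d))).
  - rewrite size_polyN; have [->|Kn0] := eqVneq K 0; first by rewrite size_poly0.
    have : (size (M *: C - F)%R <= n.*2.+1)%N.
      rewrite (leq_trans (size_polyD _ _)) // geq_max size_polyN szF andbT.
      exact: leq_trans (size_scale_leq _ _) szC.
    rewrite GE KE expr2 mulrA !size_mulXsubC ?mulf_neq0 ?polyXsubC_eq0 //.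
    case: (n) n_gt0 => //= k _; rewrite doubleS; lia.
  - move=> i j ij jm; apply: s_inc.
    + have i_ge0 : 0 <= i.+1%:R :> R by []. nra.
    + by rewrite ltr_pM2r // ltr_pM2l // ltr_nat.
    + have j_le : j.+1%:R + 1 <= 2 * n%:R :> R by rewrite natr1 -natrM ler_nat; lia.
      by rewrite piE in c_gt *; nra.
  move=> i im; set t := 2 * _ * d.
  have t_gt : d < t.
    have i_ge1 : 1 <= i.+1%:R :> R by rewrite ler1n.
    rewrite /t; nra.
  have t_lt : t < c + pi.
    have i_le : i.+1%:R + 1 <= 2 * n%:R :> R by rewrite natr1 -natrM ler_nat; lia.
    by rewrite /t; rewrite piE in c_gt *; nra.
  have [ct _] := ca t ltac:(lra).
  have st0 : s 0 < s t by apply: s_inc; lra.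
  have std : s d < s t by apply: s_inc; lra.
  have := Gval t ct.
  have -> : n%:R * t = i.+1%:R * pi by rewrite /t piE; ring.
  rewrite cos_natmul_pi GE KE !hornerM !hornerXsubC hornerN => Gt.
  have pos : 0 < w t * (s t - s d) * (s t - s 0) ^+ 2.
    by apply: mulr_gt0; [apply: mulr_gt0; rewrite ?w_gt0|apply: exprn_gt0]; rewrite ?subr_gt0.
  rewrite -(pmulr_rge0 _ pos).
  have -> : w t * (s t - s d) * (s t - s 0) ^+ 2 * ((-1) ^+ i * - K.[s t]) =
     (-1) ^+ i.+1 * (M * (-1) ^+ i.+1 - f t).
    by rewrite -Gt [(-1) ^+ i.+1]exprS; ring.
  rewrite mulrBr mulrCA -expr2 sqrr_sign mulr1 subr_ge0.
  rewrite -signr_odd; case: (odd _); rewrite ?expr0 ?expr1 ?mul1r ?mulN1r //.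
  by rewrite lerNl.
move=> t ct; have := Gval t ct.
rewrite GE KE -[K]opprK K0 oppr0 !mul0r horner0 mulr0 => /esym/eqP.
by rewrite subr_eq0 => /eqP.
Qed.

(** A form of M. Riesz's theorem: from a maximum point, a trigonometric
    polynomial of degree [n] cannot descend to zero faster than the cosine of
    the same frequency and amplitude, and the cosine is the only one that
    descends as fast.  Two admissible charts, centred at different points, cover
    the whole circle. *)
Theorem cos_extremal (n : nat) (M : R) (f : R -> R) :
  (0 < n)%N -> trig_poly n f -> (forall t, `|f t| <= M) -> f 0 = M ->
  f (pi / (2 * n)%:R) = 0 -> forall t, f t = M * cos (n%:R * t).
Proof.
move=> n_gt0 trigf f_le f0 fd t.
have pi0 : 0 < pi :> R := pi_gt0 R.
have nR : 0 < n%:R :> R by rewrite ltr0n.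
have d_gt0 : 0 < pi / n%:R :> R by rewrite divr_gt0.
have d_le : pi / n%:R <= pi :> R by rewrite ler_pdivrMr // ler_peMr // ?ler1n // ltW.
set d := pi / n%:R in d_gt0 d_le.
have chart k : 0 < k < 1 -> cos ((t - (pi - k * d)) / 2) != 0 -> f t = M * cos (n%:R * t).
  move=> k01 ct; apply: (cos_extremal_chart n M (pi - k * d)) => //.
  by rewrite -/d; nra.
have [c1|/chart->//] := eqVneq (cos ((t - (pi - 1 / 2 * d)) / 2)) 0; last by lra.
apply: (chart (1 / 4)); first by lra.
have -> : (t - (pi - 1 / 4 * d)) / 2 = (t - (pi - 1 / 2 * d)) / 2 - d / 8 by field.
rewrite cosB c1 mul0r add0r mulf_neq0 //.
  by apply/eqP => /sin0cos1; rewrite c1 normr0 => /esym/eqP; rewrite oner_eq0.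
by rewrite gt_eqF // sin_gt0_pi //; lra.
Qed.

End CosExtremal.

(** * Angles *)

Section Trigo.
Context {R : realType}.
Implicit Types a b t x : R.

Lemma cos_eq1_small x : - (2 * pi) < x < 2 * pi -> cos x = 1 -> x = 0.
Proof.
move=> /andP[x_gt x_lt]; have -> : x = (x / 2) *+ 2 by rewrite mulr2n; field.
rewrite cos_mulr2n cos2sin2 => h.
have /eqP : sin (x / 2) ^+ 2 = 0 by move: h; rewrite mulr2n; lra.
rewrite sqrf_eq0 => /eqP s0.
have [x0|x0|->] := ltgtP x 0; last by rewrite mul0r mul0rn.
  have := @sin_gt0_pi R (- (x / 2)) ltac:(lra).
  by rewrite sinN s0 oppr0 ltxx.
have := @sin_gt0_pi R (x / 2) ltac:(lra).
by rewrite s0 ltxx.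
Qed.

(** The angle is taken in [(0, 2 pi]], not in [[0, 2 pi)], because the
    parameters of the [4 n] points on the circle are the multiples
    [k pi / (2 n)] with [1 <= k <= 4 n]. *)
Lemma exists_angle a b : a ^+ 2 + b ^+ 2 = 1 ->
  exists t, [/\ 0 < t <= 2 * pi, cos t = a & sin t = b].
Proof.
move=> ab1; have pi0 := pi_gt0 R.
have a_itv : -1 <= a <= 1 by apply/andP; split; nra.
have sinE : sin (acos a) = `|b|.
  by rewrite sin_acos // -sqrtr_sqr; congr Num.sqrt; lra.
have acosa : cos (acos a) = a by apply: acosK; rewrite in_itv.
have := acos_lepi a_itv; have := acos_ge0 a_itv => a0 api.
have [b_le0|b_gt0] := lerP b 0.
  exists (2 * pi - acos a); split; first by lra.
    by rewrite mulr_natl addrC cosD2pi cosN.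
  by rewrite mulr_natl addrC sinD2pi sinN sinE ler0_norm ?opprK.
exists (acos a); split => //; last by rewrite sinE gtr0_norm.
by rewrite acos_gt0 /=; [lra|apply/andP; split; nra].
Qed.

Lemma exists_cell (N : nat) x : 0 < x <= N%:R ->
  exists2 j, (j < N)%N & j%:R < x <= j.+1%:R.
Proof.
elim: N => [|N IHN] /andP[x0 xN]; first by move: x0; rewrite ltNge xN.
have [xle|xgt] := lerP x N%:R; last by exists N; rewrite ?xgt.
by have [j jN jx] := IHN (introT andP (conj x0 xle)); exists j => //; lia.
Qed.

End Trigo.

(** * Great circles *)

Section Geometry.
Context {R : realType} {d : nat}.
Implicit Types (u v x p z : 'rV[R]_d) (a b t : R).

Lemma dotC u v : dot u v = dot v u.
Proof. by apply: eq_bigr => i _; rewrite mulrC. Qed.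

Lemma dotDl u v x : dot (u + v) x = dot u x + dot v x.
Proof. by rewrite /dot -big_split; apply: eq_bigr => i _; rewrite mxE mulrDl. Qed.

Lemma dotZl a u x : dot (a *: u) x = a * dot u x.
Proof. by rewrite /dot mulr_sumr; apply: eq_bigr => i _; rewrite mxE mulrA. Qed.

Lemma dotDr u v x : dot x (u + v) = dot x u + dot x v.
Proof. by rewrite !(dotC x) dotDl. Qed.

Lemma dotZr a u x : dot x (a *: u) = a * dot x u.
Proof. by rewrite !(dotC x) dotZl. Qed.

Definition dotE := (dotDl, dotDr, dotZl, dotZr).

Lemma dot_ge0 u : 0 <= dot u u.
Proof. by apply: sumr_ge0 => i _; rewrite -expr2 sqr_ge0. Qed.

(** Cauchy-Schwarz, from the squared length of [u] minus its projection
    on [v]. *)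
Lemma dot_unit_itv u v : sphere u -> sphere v -> -1 <= dot u v <= 1.
Proof.
rewrite /sphere /= => uu vv.
have := dot_ge0 (u + - dot u v *: v).
rewrite !dotE uu vv (dotC v u) => h; apply/andP; split; nra.
Qed.

Lemma dot_circle_point u v a b : orthonormal2 u v ->
  dot (circle_point u v a) (circle_point u v b) = cos (a - b).
Proof.
move=> [uu vv uv]; rewrite /circle_point !dotE uu vv (dotC v u) uv cosB; ring.
Qed.

Lemma circle_point_inj u v a b : orthonormal2 u v ->
  0 < a <= 2 * pi -> 0 < b <= 2 * pi ->
  circle_point u v a = circle_point u v b -> a = b.
Proof.
move=> uv ha hb ab; apply/eqP; rewrite -subr_eq0; apply/eqP/cos_eq1_small.
  lra.
by rewrite -(dot_circle_point u v) // ab dot_circle_point // subrr cos0.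
Qed.

Lemma sphere_spanP u v x : orthonormal2 u v -> sphere x ->
  x \in (<[u]> + <[v]>)%VS ->
  exists2 t, 0 < t <= 2 * pi & x = circle_point u v t.
Proof.
move=> [uu vv uv] xx /memv_addP[_ /vlineP[a ->] [_ /vlineP[b ->] xE]].
have [|t [t_itv ta tb]] := exists_angle a b.
  by rewrite -xx xE !dotE uu vv (dotC v u) uv; ring.
by exists t => //; rewrite xE /circle_point ta tb.
Qed.

Lemma mem_circle_point_span u v t : circle_point u v t \in (<[u]> + <[v]>)%VS.
Proof. by rewrite memv_add // memvZ // memv_line. Qed.

Lemma sphere_circle_point u v t : orthonormal2 u v -> sphere (circle_point u v t).
Proof. by move=> uv; rewrite /sphere /= dot_circle_point // subrr cos0. Qed.

Lemma range_circle_point u v : orthonormal2 u v ->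
  range (circle_point u v) = sphere `&` [set` (<[u]> + <[v]>)%VS].
Proof.
move=> uv; apply/seteqP; split => [_ [t _ <-]|x [xx xuv]].
  by split; [exact: sphere_circle_point|exact: mem_circle_point_span].
by have [t _ ->] := sphere_spanP u v x uv xx xuv; exists t.
Qed.

Lemma circle_range u v : orthonormal2 u v -> circle (range (circle_point u v)).
Proof.
move=> uv; exists (<[u]> + <[v]>)%VS; last exact: range_circle_point.
have [uu vv uv0] := uv.
have neq0 w : dot w w = 1 -> w != 0.
  move=> ww; apply/eqP => w0; move: ww; rewrite w0 /dot big1 => [/esym/eqP|i _].
    by rewrite oner_eq0.
  by rewrite mxE mul0r.
rewrite dimv_disjoint_sum ?dim_vline ?neq0 //.
apply/eqP; rewrite -subv0; apply/subvP => w /memv_capP[/vlineP[k ->] /vlineP[l E]].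
have : dot (k *: u) u = 0 by rewrite E dotZl dotC uv0 mulr0.
by rewrite dotZl uu mulr1 => ->; rewrite scale0r mem0v.
Qed.

Lemma range_circle_pointP u v x : orthonormal2 u v ->
  range (circle_point u v) x ->
  exists2 t, 0 < t <= 2 * pi & x = circle_point u v t.
Proof.
by move=> uv; rewrite range_circle_point // => -[xx xuv]; exact: sphere_spanP.
Qed.

End Geometry.

(** * The nearest zero *)

Section NearestZero.
Context {R : realType} {d : nat}.
Implicit Types (P : mpoly.mpoly d R) (p z : 'rV[R]_d).

Lemma sumR_continuous (T : topologicalType) (I : Type) (r : seq I) (F : I -> T -> R) :
  (forall i, continuous (F i)) -> continuous (fun x => \sum_(i <- r) F i x).
Proof.
by move=> F_cont; apply: continuous_big => // -[x y]; exact: add_continuous.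
Qed.

Lemma prodR_continuous (T : topologicalType) (I : Type) (r : seq I) (F : I -> T -> R) :
  (forall i, continuous (F i)) -> continuous (fun x => \prod_(i <- r) F i x).
Proof.
by move=> F_cont; apply: continuous_big => // -[x y]; exact: mul_continuous.
Qed.

Lemma mulR_continuous (T : topologicalType) (f g : T -> R) :
  continuous f -> continuous g -> continuous (fun x => f x * g x).
Proof. by move=> fc gc x; apply: cvgM; [exact: fc|exact: gc]. Qed.

Lemma coord0_continuous (i : 'I_d) : continuous (fun x : 'rV[R]_d => x 0 i).
Proof. exact: coord_continuous. Qed.

Lemma cstR_continuous (T : topologicalType) (c : R) : continuous (fun _ : T => c).
Proof. by move=> x; exact: cvg_cst. Qed.

Lemma dot_self_continuous : continuous (fun x : 'rV[R]_d => dot x x).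
Proof.
apply: sumR_continuous => i.
by apply: mulR_continuous; exact: coord0_continuous.
Qed.

Lemma dot_continuous p : continuous (dot p).
Proof.
apply: sumR_continuous => i; apply: mulR_continuous.
  exact: cstR_continuous.
exact: coord0_continuous.
Qed.

Lemma peval_continuous P : continuous (peval P).
Proof.
have -> : peval P = fun x => \sum_(m <- mpoly.msupp P) mpoly.mcoeff m P *
    \prod_(i < d) x 0 i ^+ mpoly.fun_of_multinom m i.
  by apply/funext => x; rewrite /peval mpoly.mevalE.
apply: sumR_continuous => m; apply: mulR_continuous.
  exact: cstR_continuous.
apply: prodR_continuous => i y.
apply: (@continuous_comp _ _ _ (fun y : 'rV[R]_d => y 0 i) (fun c : R => c ^+ _)).
  exact: coord0_continuous.
exact: exprn_continuous.
Qed.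

Lemma compact_zeros_on_sphere P : compact (zeros_on P sphere).
Proof.
have box : compact [set x : 'rV[R]_d | forall i, `[-1 : R, 1]%classic (x ord0 i)].
  by apply: (@rV_compact R d (fun=> `[-1, 1]%classic)) => i; exact: segment_compact.
apply: subclosed_compact _ box _ => [|x [xx _] i].
  have -> : zeros_on P sphere =
      (fun x => dot x x) @^-1` [set 1] `&` peval P @^-1` [set 0] by [].
  apply: closedI; apply: preimage_closed; try exact: closed_eq.
    by move=> x _; exact: dot_self_continuous.
  by move=> x _; exact: peval_continuous.
have : x 0 i ^+ 2 <= 1.
  rewrite -xx /dot (bigD1 i) //= -expr2 lerDl.
  by apply: sumr_ge0 => j _; rewrite -expr2 sqr_ge0.
by rewrite /= in_itv /= => h; apply/andP; split; nra.
Qed.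

(** The infimum is attained: the zero set is compact, and the arc cosine being
    decreasing, a nearest zero is one that maximizes [dot p]. *)
Lemma exists_nearest_zero P p : sphere p -> zeros_on P sphere !=set0 ->
  exists2 z, zeros_on P sphere z &
    angdist_set p (zeros_on P sphere) = angdist p z.
Proof.
move=> pp Z0.
have dotc : {within zeros_on P sphere, continuous (dot p)}.
  by apply: continuous_subspaceT; exact: dot_continuous.
have [z /set_mem zZ z_max] := EVT_max_rV Z0 (compact_zeros_on_sphere P) dotc.
exists z => //.
have lb : lbound [set angdist p x | x in zeros_on P sphere] (angdist p z).
  move=> _ [x xZ <-]; rewrite /angdist leNgt.
  have itvx := dot_unit_itv p x pp xZ.1; have itvz := dot_unit_itv p z pp zZ.1.
  rewrite -ltr_cos; last 2 first.
  - by rewrite in_itv /= acos_ge0 // acos_lepi.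
  - by rewrite in_itv /= acos_ge0 // acos_lepi.
  by rewrite !acosK ?in_itv //= -leNgt; apply/z_max/mem_set.
apply/le_anti/andP; split; last by apply: lb_le_inf => //; exists (angdist p z), z.
by apply: ge_inf; [exists (angdist p z)|exists z].
Qed.

End NearestZero.

(** * A polynomial that is a cosine on a great circle *)

Section CosineOnCircle.
Context {R : realType} {d : nat}.

Lemma interlace_cosine (n : nat) (P : mpoly.mpoly d R) (A : R) (u v : 'rV[R]_d) :
  (0 < n)%N -> A != 0 -> orthonormal2 u v ->
  (forall t, peval P (circle_point u v t) = A * cos (n%:R * t)) ->
  let Sigma := range (circle_point u v) in
  [/\ zeros_on P Sigma #= `I_(2 * n), abs_max_on P Sigma #= `I_(2 * n) &
      interlace_and_split n Sigma (zeros_on P Sigma) (abs_max_on P Sigma)].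
Proof.
move=> n_gt0 A0 uv PE Sigma.
have pi0 : 0 < pi :> R := pi_gt0 R.
have n_ge1 : 1 <= n%:R :> R by rewrite ler1n.
pose e : R := pi / (2 * n)%:R.
have piE : pi = 2 * n%:R * e by rewrite /e natrM; field; rewrite gt_eqF //; lra.
have e_gt0 : 0 < e by rewrite divr_gt0 // ltr0n muln_gt0.
pose t (k : nat) : R := k.+1%:R * e.
pose q k := circle_point u v (t k).
have t_itv k : (k < 4 * n)%N -> 0 < t k <= 2 * pi.
  move=> kn; have : k.+1%:R <= (4 * n)%:R :> R by rewrite ler_nat.
  rewrite natrM => k_le; have k_gt0 : 0 < k.+1%:R :> R by [].
  by rewrite piE /t; apply/andP; split; nra.
have q_inj k k' : (k < 4 * n)%N -> (k' < 4 * n)%N -> q k = q k' -> k = k'.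
  move=> kn kn' /(circle_point_inj _ _ _ _ uv (t_itv k kn) (t_itv k' kn')) /eqP.
  by rewrite /t (inj_eq (mulIf (lt0r_neq0 e_gt0))) eqr_nat => /eqP[].
(* Cutting [(0, 2 pi]] into [2 n] arcs of length [pi / n], the cosine has one
   zero, the midpoint, and one extremum, the right end point, in each arc. *)
have cell a : 0 < a <= 2 * pi -> exists2 j, (j < 2 * n)%N &
    exists2 y, 0 < y <= pi & n%:R * a = y + j%:R * pi /\ a = 2 * j%:R * e + y / n%:R.
  move=> /andP[a_gt0 a_le].
  have [|j jn /andP[ja aj]] := exists_cell (2 * n) (n%:R * a / pi).
    rewrite divr_gt0 ?mulr_gt0 //=; last by lra.
    by rewrite ler_pdivrMr // natrM; nra.
  exists j => //; exists (n%:R * a - j%:R * pi).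
    move: ja aj; rewrite ltr_pdivlMr // ler_pdivrMr // -natr1; lra.
  split; first by ring.
  by rewrite piE; field; rewrite gt_eqF //; lra.
have cosDjpi (y : R) (j : nat) : cos (y + j%:R * pi) = (-1) ^+ j * cos y.
  by rewrite mulr_natl (alternatingn (@cosDpi R)).
have q_even j : peval P (q (2 * j)%N) = 0.
  rewrite PE; have -> : n%:R * t (2 * j)%N = pi / 2 + j%:R * pi.
    by rewrite piE /t -natr1 natrM; field.
  by rewrite cosDjpi cos_pihalf !mulr0.
have q_odd j : `|peval P (q (2 * j).+1)| = `|A|.
  rewrite PE; have -> : n%:R * t (2 * j).+1 = 0 + j.+1%:R * pi.
    by rewrite piE /t -!natr1 natrM; ring.
  by rewrite cosDjpi cos0 mulr1 normrM normrX normrN1 expr1n mulr1.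
have P_le x : Sigma x -> `|peval P x| <= `|A|.
  by move=> [a _ <-]; rewrite PE normrM ler_piMr // cos_max.
have ZE : zeros_on P Sigma = [set q (2 * j)%N | j in `I_(2 * n)].
  apply/seteqP; split => [x [Sx]|_ [j _ <-]]; last by split=> //; exists (t (2 * j)%N).
  have [a a_itv ->] := range_circle_pointP u v x uv Sx.
  have [j jn [y y_itv [naE aE]]] := cell a a_itv.
  rewrite PE naE cosDjpi => /eqP.
  rewrite !mulf_eq0 (negbTE A0) signr_eq0 /= => /eqP cy0.
  exists j => //; rewrite /q; congr circle_point.
  have yE : y = pi / 2.
    by apply: cos_inj; rewrite ?in_itv /= ?cos_pihalf //; lra.
  by rewrite aE yE piE /t -natr1 natrM; field; rewrite gt_eqF //; lra.
have ME : abs_max_on P Sigma = [set q (2 * j).+1 | j in `I_(2 * n)].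
  apply/seteqP; split => [x [Sx x_max]|_ [j _ <-]]; last first.
    by split=> [|y /P_le]; [exists (t (2 * j).+1)|rewrite q_odd].
  have : `|peval P x| = `|A|.
    apply/le_anti; rewrite P_le //= -(q_odd 0%N); apply: x_max.
    by exists (t (2 * 0).+1).
  have [a a_itv ->] := range_circle_pointP u v x uv Sx.
  have [j jn [y y_itv [naE aE]]] := cell a a_itv.
  rewrite PE naE cosDjpi !normrM normrX normrN1 expr1n mul1r => /eqP.
  rewrite -[X in _ == X]mulr1 (inj_eq (mulfI _)) ?normr_eq0 // => /eqP /cos1sin0 sy0.
  exists j => //; rewrite /q; congr circle_point.
  have yE : y = pi.
    apply/eqP; rewrite eq_le (andP y_itv).2 leNgt; apply/negP => y_lt.
    by have := @sin_gt0_pi R y; rewrite (andP y_itv).1 y_lt sy0 ltxx => /(_ isT).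
  by rewrite aE yE piE /t -!natr1 natrM; field; rewrite gt_eqF //; lra.
split.
- rewrite ZE; apply: inj_card_eq => i j; rewrite !inE /= => i_n j_n /q_inj; lia.
- rewrite ME; apply: inj_card_eq => i j; rewrite !inE /= => i_n j_n /q_inj; lia.
have tS k : t k.+1 - t k = e by rewrite /t -[k.+2%:R]natr1; ring.
exists u, v, t; split => //.
- split=> [k _|]; first by rewrite -subr_gt0 tS.
  by rewrite /t piE -natr1 natrM; ring.
- move=> k _; rewrite /angdist dot_circle_point // -opprB cosN tS cosK //.
  by rewrite in_itv /= piE; nra.
Qed.

End CosineOnCircle.

(** * The interlacing theorem *)

Theorem theorem1p3 (R : realType) (d n : nat) (hd : (1 <= d)%N) (hn : (1 <= n)%N)
    (P : mpoly.mpoly d R) (hdeg : has_degree P n)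
    (hnz : exists2 x : 'rV[R]_d, sphere x & peval P x <> 0)
    (p : 'rV[R]_d) (hmax : abs_max_on P sphere p)
    (hZ : zeros_on P sphere !=set0)
    (hdist : angdist_set p (zeros_on P sphere) = pi / (2 * n)%:R) :
  exists Sigma : set 'rV[R]_d,
    [/\ circle Sigma,
        Sigma p,
        zeros_on P Sigma #= `I_(2 * n),
        abs_max_on P Sigma #= `I_(2 * n) &
        interlace_and_split n Sigma (zeros_on P Sigma) (abs_max_on P Sigma)].
Proof.
have [pp p_max] := hmax; have [x xx Px] := hnz.
have Pp : peval P p != 0.
  apply/eqP => Pp0; have := p_max x xx.
  by rewrite Pp0 normr0 normr_le0 => /eqP.
have pi0 : 0 < pi :> R := pi_gt0 R.
set e := pi / _ in hdist.
have e_gt0 : 0 < e by rewrite divr_gt0 // ltr0n muln_gt0.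
have e_lt : e < pi.
  by rewrite ltr_pdivrMr ?ltr0n ?muln_gt0 // ltr_pMr // ltr1n; lia.
have [z [zz Pz] zE] := exists_nearest_zero P p pp hZ.
have pz : dot p z = cos e.
  by rewrite -hdist zE acosK // in_itv; exact: dot_unit_itv.
have se : 0 < sin e by rewrite sin_gt0_pi // e_gt0.
pose v := (sin e)^-1 *: (z + - cos e *: p).
have pv : orthonormal2 p v.
  rewrite /sphere /= in pp zz.
  split => //; rewrite /v !dotE; last by rewrite pz pp; ring.
  rewrite (dotC z p) pz pp zz.
  transitivity ((1 - cos e ^+ 2) / sin e ^+ 2); first by field; rewrite gt_eqF.
  by rewrite -sin2cos2 divff // expf_neq0 // gt_eqF.
have cp0 : circle_point p v 0 = p.
  by rewrite /circle_point cos0 sin0 scale1r scale0r addr0.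
have cpe : circle_point p v e = z.
  by rewrite /circle_point /v scalerA mulfV ?gt_eqF // scale1r addrC scaleNr subrK.
(* The factor [peval P p] makes the value at [p] positive whatever its sign. *)
pose f t := peval P p * peval P (circle_point p v t).
have fE : forall t, f t = peval P p ^+ 2 * cos (n%:R * t).
  apply: cos_extremal => //.
  - by apply: trig_polyZ; exact: trig_poly_circle.
  - move=> t; rewrite /f normrM -real_normK ?num_real // expr2 ler_wpM2l //.
    by apply: p_max; exact: sphere_circle_point.
  - by rewrite /f cp0.
  - by rewrite /f cpe Pz mulr0.
have PE t : peval P (circle_point p v t) = peval P p * cos (n%:R * t).
  by apply: (mulfI Pp); rewrite -/(f t) fE expr2 mulrA.
have [Zcard Mcard split] := interlace_cosine n P (peval P p) p v hn Pp pv PE.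
exists (range (circle_point p v)); split => //; first exact: circle_range.
by exists 0.
Qed.
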